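(* Let $R$ be a finite commutative local ring with identity of size $p^s$, with $p$ an odd prime and $s\in\mathbb{N}$, having prime residue field $\mathbb{F}_p$ (for instance, $\mathbb{Z}_{p^s}$ or $\mathbb{Z}_p[x]/(x^s)$). Then $$g_R(2)=\begin{cases}2, & \text{if } p\equiv1\pmod4,\\ 3, & \text{if } p\equiv3\pmod4,\end{cases}$$ and also $g_R(\frac{p-1}{2})=\frac{p-1}{2}$ for $p\ge5$ and $g_R(p-1)=p$.
   Context: The Waring number $g_R(k)$ is the minimum $s_0\in\mathbb{N}$, if it exists, such that $x_1^k+\cdots+x_{s_0}^k=r$ has a solution in $R$ for every $r\in R$.
   Formalization: The values g_R(2)=3 (p≡3 mod 4) and g_R(p-1)=p are stated only for s≥2; for s=1, R is the field F_p, where g_R(2)=2 and g_R(p-1)=p-1, so these two claims fail as written. *)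

(* Defs.v *)
From HB Require Import structures.
From mathcomp Require Import all_boot all_algebra.
Set Implicit Arguments.
Unset Strict Implicit.
Unset Printing Implicit Defensive.

Import GRing.Theory.
Local Open Scope ring_scope.

(* An [idealr] is proper by definition (it does not contain 1), so maximality
   is among all the ideals of type [idealr R]. *)
Definition maximal_ideal (R : comNzRingType) (m : idealr R) : Prop :=
  forall J : idealr R, {subset m <= J} -> J =i m.

Definition local_ring_with (R : comNzRingType) (m : idealr R) : Prop :=
  maximal_ideal m /\ (forall J : idealr R, maximal_ideal J -> J =i m).

Definition ring_isomorphic (A B : nzRingType) : Prop :=
  exists f : {rmorphism A -> B}, bijective f.

Definition all_sums_of_powers (R : nzRingType) (k t : nat) : Prop :=
  forall r : R, exists x : 'I_t -> R, \sum_(i < t) x i ^+ k = r.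

(* The Waring number is a partial function of (R, k): [is_waring_number R k g]
   says that g_R(k) exists and equals g. *)
Definition is_waring_number (R : nzRingType) (k g : nat) : Prop :=
  all_sums_of_powers R k g /\
  (forall t : nat, all_sums_of_powers R k t -> (g <= t)%N).

(* Main.v *)
Require Import Defs.
From HB Require Import structures.
From mathcomp Require Import all_boot all_algebra all_field.
From mathcomp Require Import zify ring.

(** The residue map [f : R -> 'F_p] has kernel [m], and locality makes every
    element outside [m] invertible.  If [p] does not divide [k], then
    [x |-> x ^+ k] is injective on the finite set [1 + m], since
    [x ^+ k - z ^+ k = (x - z) * s] with [s] congruent to [k], hence a unit.
    So it is onto [1 + m], and an element whose residue is a nonzero [k]-th
    power is itself a [k]-th power ([unit_power_lift]).

    Upper bounds thus reduce to [F_p], provided that some summand is a unit.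
    An element of residue [c > 0] is a sum of [c] powers, all but one of them
    equal to [1] ([sum_of_powers_residue]); this gives [p] for [k = p - 1].
    For [k = (p - 1) / 2] the element [-1] is a [k]-th power too, so that
    residues larger than [k] are reached by negation.  For squares, if
    [p = 1 mod 4] then [-1 = i ^+ 2] and
    [4 r = (r + 1) ^+ 2 + (i (r - 1)) ^+ 2]; if [p = 3 mod 4], a unit is a sum
    of two squares, and one of [r] and [r - 1] is a unit.

    Lower bounds.  For [p = 1 mod 4], squaring is not injective on [R], hence
    not onto.  For [k = (p - 1) / 2] the powers have residues [-1], [0], [1],
    so that [t] summands reach at most [2 t + 1] residues.  In the other two
    cases the obstruction lies in the maximal ideal.  When [m != 0], some [z] in
    [m] is outside an ideal containing all products of two elements of [m]
    ([nakayama_set]), so [z] is not a sum of [k]-th powers of elements of [m].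
    Any representation of [z] then has a unit summand.  For [k = p - 1]
    the number of unit summands is divisible by [p], as each has residue [1].
    For two squares with [p = 3 mod 4] a unit summand cannot occur, because
    [-1] is not a square in [F_p]. *)

Set Implicit Arguments.
Unset Strict Implicit.

Import GRing.Theory.

(** * Ideals of a finite ring as finite sets *)

Section IdealSets.

Local Open Scope ring_scope.

Variable R : finComNzRingType.
Implicit Types (A : {set R}) (x z : R).

(** Ideals are encoded by a boolean predicate on finite sets, so that maximal
    ones exist by [maxset_exists]; the unit ideal is allowed. *)
Definition ideal_set A : bool :=
  (0 \in A) && [forall a, forall u in A, forall v in A, a * u + v \in A].

(** The ideal [A + R z], when [A] is an ideal. *)
Definition adjoin A z : {set R} := [set x | [exists r, x - r * z \in A]].

Lemma ideal_setP A :
  reflect (0 \in A /\ forall a, {in A &, forall u v, a * u + v \in A})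
          (ideal_set A).
Proof.
apply: (iffP andP) => -[A0 AD]; split=> //.
  move=> a u v uA vA.
  by move/forallP/(_ a)/forall_inP/(_ u uA)/forall_inP: AD; apply.
by apply/forallP=> a; apply/forall_inP=> u uA; apply/forall_inP=> v vA; apply: AD.
Qed.

Lemma ideal_setD A : ideal_set A -> {in A &, forall u v, u + v \in A}.
Proof. by move=> /ideal_setP[_ AD] u v uA vA; rewrite -[u]mul1r AD. Qed.

Lemma ideal_setM A a u : ideal_set A -> u \in A -> a * u \in A.
Proof. by move=> /ideal_setP[A0 AD] uA; rewrite -[_ * _]addr0 AD. Qed.

Lemma ideal_set0 : ideal_set [set 0].
Proof.
apply/ideal_setP; split=> [|a u v]; rewrite !inE // => /eqP-> /eqP->.
by rewrite mulr0 addr0.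
Qed.

Lemma ideal_set_adjoin A z : ideal_set A -> ideal_set (adjoin A z).
Proof.
move=> iA; have [A0 AD] := ideal_setP _ iA; apply/ideal_setP; split.
  by rewrite inE; apply/existsP; exists 0; rewrite mul0r subr0.
move=> a u v; rewrite !inE => /existsP[r ur] /existsP[r' vr'].
apply/existsP; exists (a * r + r').
by have -> : a * u + v - (a * r + r') * z = a * (u - r * z) + (v - r' * z);
  [ring | apply: AD].
Qed.

Lemma sub_adjoin A z : A \subset adjoin A z.
Proof.
apply/subsetP=> x xA; rewrite inE; apply/existsP; exists 0.
by rewrite mul0r subr0.
Qed.

Lemma mem_adjoin A z : ideal_set A -> z \in adjoin A z.
Proof.
move=> /ideal_setP[A0 _]; rewrite inE; apply/existsP; exists 1.
by rewrite mul1r subrr.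
Qed.

Lemma idealr_of_set A : ideal_set A -> 1 \notin A -> exists J : idealr R, J =i A.
Proof.
move=> /ideal_setP[A0 AD] A1.
have hA : idealr_closed (fun x => x \in A) by split.
pose H := isIdealr.Build R (fun x => x \in A) hA.
pose J : idealr R := HB.pack (fun x : R => x \in A) H.
by exists J.
Qed.

Lemma ideal_set_of_idealr (J : idealr R) :
  ideal_set [set x | x \in J] /\ 1 \notin [set x | x \in J].
Proof.
split; last by rewrite inE idealr1.
apply/ideal_setP; split=> [|a u v]; rewrite !inE ?idealr0 // => uJ vJ.
by rewrite rpredD ?idealMr.
Qed.

(** A non-invertible [x] generates a proper ideal, which lies in a maximal one;
    by uniqueness that ideal is [m]. *)
Lemma local_ring_unit (m : idealr R) x :
  local_ring_with m -> x \notin m -> exists y, x * y = 1.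
Proof.
move=> [_ m_unique] xm; apply/exists_eqP; apply: contraNT xm => /existsPn xN.
pose proper A := ideal_set A && (1 \notin A).
have px : proper (adjoin [set 0] x).
  rewrite /proper ideal_set_adjoin ?ideal_set0 //=; rewrite inE.
  apply/existsPn=> r; rewrite inE subr_eq0 eq_sym mulrC; exact: xN.
have [M /maxsetP[/andP[iM M1] maxM] /subsetP xM] := maxset_exists px.
have [J JM] := idealr_of_set iM M1.
have Jmax : maximal_ideal J.
  move=> K JK y; have [iK K1] := ideal_set_of_idealr K.
  rewrite JM -(maxM [set x | x \in K]) ?inE //; first by rewrite /proper iK.
  by apply/subsetP=> z; rewrite inE -JM; apply: JK.
by rewrite -(m_unique J Jmax) JM xM // mem_adjoin ?ideal_set0.
Qed.

(** Nakayama's lemma in the form [I * I != I].  Take [J] maximal among the ideals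
    strictly below [I].  If [x * y] were outside [J] for [x, y] in [I], then
    [J + R x y] would be [I] and contain [x], so that [x * (1 - r y)] is in [J]
    for some [r]; as [1 - r y] is invertible, [x] and [x * y] would be in [J]. *)
Lemma nakayama_set (I : {set R}) :
    ideal_set I -> I != [set 0] ->
    {in I, forall y, exists z, (1 - y) * z = 1} ->
  exists2 J : {set R}, ideal_set J /\ {in I &, forall x y, x * y \in J}
    & exists2 x, x \in I & x \notin J.
Proof.
move=> iI I0 I1; pose below A := ideal_set A && (A \proper I).
have b0 : below [set 0].
  by rewrite /below ideal_set0 properEneq eq_sym I0 sub1set; case/ideal_setP: iI.
have [J /maxsetP[/andP[iJ JI] maxJ] _] := maxset_exists b0.
have /properP[/subsetP sJI [x0 x0I x0J]] := JI.
exists J; last by exists x0.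
split=> // x y xI yI; have [xJ|xJ] := boolP (x \in J).
  by rewrite mulrC ideal_setM.
apply: contraNT xJ => xyJ.
have : x \in adjoin J (x * y).
  suff -> : adjoin J (x * y) = I by [].
  apply/eqP; apply: contraNT xyJ => ne.
  rewrite -(maxJ (adjoin J (x * y))) ?sub_adjoin ?mem_adjoin //.
  rewrite /below ideal_set_adjoin //= properEneq ne /=; apply/subsetP=> z.
  rewrite inE => /existsP[r zr]; rewrite -[z](subrK (r * (x * y))).
  by apply: ideal_setD; [|exact: sJI|exact/(ideal_setM _ iI)/(ideal_setM _ iI)].
rewrite inE => /existsP[r xr].
have [z Ez] := I1 (r * y) (ideal_setM _ iI yI).
suff -> : x = z * (x - r * (x * y)) by rewrite ideal_setM.
by transitivity ((1 - r * y) * z * x); [rewrite Ez mul1r | ring].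
Qed.

Lemma residue_morphism (p : nat) (m : idealr R) :
    ring_isomorphic {ideal_quot m} 'F_p ->
  exists f : {rmorphism R -> 'F_p}, forall x, (f x == 0) = (x \in m).
Proof.
move=> [g /bij_inj g_inj].
pose f : {rmorphism R -> 'F_p} := g \o (\pi_{ideal_quot m})%qT.
exists f => x; rewrite /f /= -(rmorph0 g) (inj_eq g_inj).
by rewrite -{2}[x]subr0 Quotient.idealrBE /= rmorph0.
Qed.

End IdealSets.

(** * Powers in the prime field *)

Section PrimeFieldSquares.

Local Open Scope ring_scope.
Variables (p : nat) (p_prime : prime p).

Lemma Fp_natr_eq0 n : (n%:R == 0 :> 'F_p) = (p %| n)%N.
Proof. by rewrite (dvdn_pcharf (pchar_Fp p_prime)). Qed.

Lemma Fp_fermat (a : 'F_p) : a != 0 -> a ^+ p.-1 = 1.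
Proof.
move=> a0; apply: (mulfI a0).
rewrite mulr1 -exprS prednK ?prime_gt0 // -[X in a ^+ X](card_Fp p_prime).
exact: expf_card.
Qed.

Lemma Fp_half_power (p_odd : odd p) (a : 'F_p) :
  a != 0 -> a ^+ (p.-1)./2 = 1 \/ a ^+ (p.-1)./2 = -1.
Proof.
move=> a0; have : (a ^+ (p.-1)./2) ^+ 2 == 1.
  rewrite -exprM muln2 halfK -subn1 oddB ?prime_gt0 // p_odd subn0 subn1.
  by rewrite Fp_fermat.
by rewrite sqrf_eq1 => /orP[] /eqP; [left | right].
Qed.

(** All these powers are [1] or [-1]; without the value [-1], the polynomial
    [X ^ ((p - 1) / 2) - 1] would have [p - 1] roots. *)
Lemma Fp_nonresidue (p_odd : odd p) :
  exists2 a : 'F_p, a != 0 & a ^+ (p.-1)./2 = -1.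
Proof.
have [p1 p2] := (prime_gt1 p_prime, odd_prime_gt2 p_odd p_prime).
have [/existsP[a /andP[a0 /eqP Ea]]|/existsPn no] :=
    boolP [exists a : 'F_p, (a != 0) && (a ^+ p.-1./2 == -1)].
  by exists a.
have h0 : (0 < p.-1./2)%N by lia.
pose q : {poly 'F_p} := 'X^(p.-1./2) - 1.
have sq : size q = (p.-1./2).+1 by rewrite size_XnsubC.
have : (size (enum (predC1 (0%R : 'F_p))) < size q)%N.
  apply: max_poly_roots; rewrite ?enum_uniq -?size_poly_eq0 ?sq //.
  apply/allP=> a; rewrite mem_enum inE => a0.
  rewrite rootE !hornerE subr_eq0; apply/eqP.
  by have := no a; case: (Fp_half_power p_odd a0) => // ->; rewrite a0 eqxx.
by rewrite sq -cardE cardC1 card_Fp //; lia.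
Qed.

(** Pigeonhole: the squares of [0, ..., (p - 1) / 2] are distinct, so the
    [(p + 1) / 2] squares [u] and the [(p + 1) / 2] elements [a - u] cannot be
    disjoint. *)
Lemma Fp_sum_two_squares (p_odd : odd p) (a : 'F_p) :
  exists x y : 'F_p, a = x ^+ 2 + y ^+ 2.
Proof.
pose h := p.-1./2; have Dp : p = (h.*2.+1)%N.
  by rewrite /h halfK -subn1 oddB ?prime_gt0 // p_odd subn0 subn1 prednK ?prime_gt0.
pose sq (i : 'I_h.+1) : 'F_p := (i%:R) ^+ 2.
have sq_inj : injective sq.
  move=> i j /eqP; rewrite eqf_sqr -addr_eq0 -subr_eq0 -natrD.
  wlog ij : i j / (j <= i)%N.
    move=> W; case/orP: (leq_total j i) => ij; first exact: W.
    move=> H; apply/esym/W => //; rewrite addnC -opprB oppr_eq0.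
    exact: H.
  rewrite -natrB // !Fp_natr_eq0 => H; apply: val_inj => /=.
  have [hi hj] := (ltn_ord i, ltn_ord j).
  case/orP: H => H; [have := @dvdn_leq p (i - j) | have := @dvdn_leq p (i + j)].
    by move/(_ _ H); lia.
  by move/(_ _ H); lia.
pose A := [set sq i | i in 'I_h.+1]; pose B := [set a - u | u in A].
have cA : #|A| = h.+1 by rewrite card_imset ?card_ord.
have cB : #|B| = h.+1 by rewrite card_imset // => u v /addrI/oppr_inj.
have : A :&: B != set0.
  apply/negP=> /eqP AB; have := cardsUI A B; rewrite AB cards0 addn0 cA cB.
  have := max_card [set x in A :|: B]; rewrite card_Fp // cardsE; lia.
case/set0Pn=> u; rewrite inE => /andP[/imsetP[i _ ->] /imsetP[v /imsetP[j _ ->]]].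
by move=> E; exists (i%:R), (j%:R); rewrite -/(sq i) -/(sq j) E subrK.
Qed.

End PrimeFieldSquares.

(** * Sums of [t] powers *)

Section SumsOfPowers.

Local Open Scope ring_scope.
Variables (R : comNzRingType) (k : nat).

Definition sum_of_powers (t : nat) (r : R) : Prop :=
  exists x : 'I_t -> R, \sum_(i < t) x i ^+ k = r.

Lemma sum_of_powersD t u r s :
  sum_of_powers t r -> sum_of_powers u s -> sum_of_powers (t + u) (r + s).
Proof.
move=> [x <-] [y <-].
exists (fun i => match split i with inl j => x j | inr j => y j end).
rewrite big_split_ord; congr (_ + _); apply: eq_bigr => j _ /=.
  by rewrite -[lshift _ j]/(unsplit (inl j)) unsplitK.
by rewrite -[rshift _ j]/(unsplit (inr j)) unsplitK.
Qed.

Lemma sum_of_powers1 a : sum_of_powers 1 (a ^+ k).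
Proof. by exists (fun=> a); rewrite big_ord1. Qed.

Lemma sum_of_powers_nat n : sum_of_powers n n%:R.
Proof.
exists (fun=> 1); rewrite (eq_bigr (fun=> 1)) => [|i _]; last by rewrite expr1n.
by rewrite sumr_const card_ord.
Qed.

Lemma sum_of_powers_leq t u r :
  (0 < k)%N -> (t <= u)%N -> sum_of_powers t r -> sum_of_powers u r.
Proof.
move=> k0 /subnKC<- hr; rewrite -[r]addr0; apply: sum_of_powersD => //.
by exists (fun=> 0); rewrite big1 // => i _; rewrite expr0n eqn0Ngt k0.
Qed.

Lemma sum_of_powersM t r a : sum_of_powers t r -> sum_of_powers t (a ^+ k * r).
Proof.
move=> [x <-]; exists (fun i => a * x i); rewrite mulr_sumr.
by apply: eq_bigr => i _; rewrite exprMn.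
Qed.

End SumsOfPowers.

(** * Lifting powers from the residue field *)

Section ResidueMap.

Local Open Scope ring_scope.
Variables (p : nat) (p_prime : prime p) (R : finComNzRingType).
Variable f : {rmorphism R -> 'F_p}.
Hypothesis f_unit : forall x, f x != 0 -> exists y, x * y = 1.

Lemma residue_lift (a : 'F_p) : exists x : R, f x = a.
Proof. by exists (a%:R); rewrite rmorph_nat natr_Zp. Qed.

(** This replaces Hensel's lemma: an injective self-map of the finite set of
    elements of residue [1] is onto. *)
Lemma principal_unit_power (k : nat) (y : R) :
  ~~ (p %| k)%N -> f y = 1 -> exists2 x, x ^+ k = y & f x = 1.
Proof.
move=> pk fy; pose U := [set x | f x == 1].
have inj : {in U &, injective (fun x : R => x ^+ k)}.
  move=> x z; rewrite !inE => /eqP fx /eqP fz /eqP; rewrite -subr_eq0 subrXX.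
  move=> /eqP E; apply/eqP; rewrite -subr_eq0; apply/eqP.
  set s := \sum_(i < k) _ in E.
  have fs : f s = k%:R.
    rewrite rmorph_sum (eq_bigr (fun=> 1)) ?sumr_const ?card_ord // => i _.
    by rewrite rmorphM !rmorphXn fx fz !expr1n mulr1.
  have [|v sv] := f_unit (x := s); first by rewrite fs Fp_natr_eq0.
  by rewrite -[x - z]mulr1 -sv mulrA E mul0r.
have sub : [set x ^+ k | x in U] \subset U.
  apply/subsetP=> w /imsetP[x]; rewrite !inE => /eqP fx ->.
  by rewrite rmorphXn fx expr1n.
have /setP/(_ y) : [set x ^+ k | x in U] = U.
  by apply/eqP; rewrite eqEcard sub card_in_imset /=.
rewrite [RHS]inE fy eqxx => /imsetP[x]; rewrite inE => /eqP fx ->.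
by exists x.
Qed.

Lemma unit_power_lift (k : nat) (x y : R) :
  ~~ (p %| k)%N -> f x != 0 -> f y = f x ^+ k -> exists z, z ^+ k = y.
Proof.
move=> pk fx fy; have [v xv] := f_unit fx.
have fv : f x * f v = 1 by rewrite -rmorphM xv rmorph1.
have [|z Ez _] := @principal_unit_power k (y * v ^+ k) pk.
  by rewrite rmorphM rmorphXn fy -exprMn fv expr1n.
by exists (x * z); rewrite exprMn Ez mulrCA -exprMn xv expr1n mulr1.
Qed.

(** [r - (c - 1)] has residue [1], so it is a [k]-th power, and [c - 1] is a sum
    of [c - 1] ones. *)
Lemma sum_of_powers_residue (k c t : nat) (r : R) :
    ~~ (p %| k)%N -> (0 < c <= t)%N -> f r = c%:R -> sum_of_powers k t r.
Proof.
move=> pk /andP[c0 ct] fr; have k0 : (0 < k)%N by case: k pk; rewrite ?dvdn0.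
apply: (@sum_of_powers_leq _ _ c) => //.
have [|z Ez _] := @principal_unit_power k (r - (c.-1)%:R) pk.
  rewrite rmorphB fr rmorph_nat -natrB ?leq_pred //.
  by rewrite (_ : c - c.-1 = 1)%N //; lia.
rewrite -[r](subrK (c.-1)%:R) -Ez -{1}(prednK c0) -add1n.
by apply: sum_of_powersD; [apply: sum_of_powers1 | apply: sum_of_powers_nat].
Qed.

(** For a lower bound on [t]: to reach the residue [-1] this way requires
    [p - 1 <= b * t]. *)
Lemma sum_residues_le (t b : nat) (e : 'I_t -> 'F_p) :
    (forall i, (e i <= b)%N) ->
  exists2 n, (n <= b * t)%N & \sum_(i < t) e i = n%:R.
Proof.
move=> he; exists (\sum_(i < t) e i)%N.
  have -> : (b * t = \sum_(i < t) b)%N by rewrite sum_nat_const card_ord mulnC.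
  exact: leq_sum.
by rewrite natr_sum; apply: eq_bigr => i _; rewrite natr_Zp.
Qed.

(** Zero is represented by [p], because [sum_of_powers_residue] needs at least
    one unit summand. *)
Lemma Fp_residue_pos (a : 'F_p) : exists2 c, (0 < c <= p)%N & a = c%:R.
Proof.
have ap : (a < p)%N by have := ltn_ord a; rewrite [X in (_ < X)%N](Fp_cast p_prime).
have [a0|a0] := posnP (nat_of_ord a); last first.
  by exists (nat_of_ord a); [rewrite a0 ltnW | rewrite natr_Zp].
exists p; first by rewrite prime_gt0 // leqnn.
by rewrite pchar_Fp_0 // -[a]natr_Zp a0.
Qed.

(** * Waring numbers *)

Lemma waring_squares_1mod4 : p = 1 %[mod 4] -> is_waring_number R 2 2.
Proof.
move=> p14; have p_odd : odd p by lia.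
have p2 := odd_prime_gt2 p_odd p_prime.
have two_unit : f 2%:R != 0.
  by rewrite rmorph_nat Fp_natr_eq0 // gtnNdvd.
have [h Eh] := f_unit two_unit; split.
  (* A square root of -1 in F_p is a ^ ((p - 1) / 4), for a nonresidue a. *)
  have [a a0 Ea] := Fp_nonresidue p_prime p_odd.
  have [x fx] := residue_lift (a ^+ (p %/ 4)).
  have [|||i Ei] := @unit_power_lift 2 x (-1).
  - by rewrite gtnNdvd.
  - by rewrite fx expf_neq0.
  - by rewrite rmorphN1 fx -exprM -Ea; congr (a ^+ _); lia.
  move=> r; rewrite -[r]mul1r.
  have -> : 1 * r = (h * (r + 1)) ^+ 2 + (h * (i * (r - 1))) ^+ 2.
    transitivity ((2%:R * h) ^+ 2 * r); first by rewrite Eh expr1n.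
    rewrite !exprMn Ei; ring.
  by apply: (@sum_of_powersD _ 2 1 1); apply: sum_of_powers1.
move=> [|[|//]] sq.
  have [x] := sq 1; rewrite big_ord0 => /esym/eqP; by rewrite oner_eq0.
have sq_surj (r : R) : exists x, x ^+ 2 == r.
  by have [x <-] := sq r; exists (x ord0); rewrite big_ord1.
have sq_inj : injective (fun x : R => x ^+ 2).
  have onto : [set x ^+ 2 | x : R] = [set: R].
    apply/setP=> r; rewrite inE; apply/imsetP.
    by have [x /eqP<-] := sq_surj r; exists x.
  move=> x y; have /imset_injP : #|[set x ^+ 2 | x : R]| == #|R|.
    by rewrite onto cardsT.
  by apply.
have : (1 : R) = -1 by apply: sq_inj; rewrite /= sqrrN.
by move=> E; case/eqP: two_unit; rewrite mulr2n {2}E subrr rmorph0.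
Qed.

Lemma waring_half_p_minus1 :
  (5 <= p)%N -> is_waring_number R ((p - 1) %/ 2) ((p - 1) %/ 2).
Proof.
move=> p5; have p_odd : odd p.
  by case: (even_prime p_prime) => // p2; rewrite p2 in p5.
have Dk : ((p - 1) %/ 2 = p.-1./2)%N by lia.
rewrite Dk; set k := p.-1./2; have Dp : p = k.*2.+1 by rewrite /k; lia.
have pk : ~~ (p %| k)%N by rewrite gtnNdvd //; lia.
split.
  have [a a0 Ea] := Fp_nonresidue p_prime p_odd.
  have [x fx] := residue_lift a.
  have [||b Eb] := @unit_power_lift k x (-1) pk.
  - by rewrite fx.
  - by rewrite rmorphN1 fx Ea.
  move=> r; have [c /andP[c0 cp] fr] := Fp_residue_pos (f r).
  have [ck|kc] := leqP c k; first by apply: sum_of_powers_residue fr; rewrite ?c0.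
  (* Residue 0 costs two summands, r + 1 and -1, and k >= 2 since p >= 5. *)
  have [Ec|cp'] := eqVneq c p.
    have -> : r = (r + 1) + b ^+ k by rewrite Eb addrK.
    apply: (@sum_of_powers_leq _ _ (1 + 1)); [lia | lia | apply: sum_of_powersD].
      apply: (@sum_of_powers_residue _ 1) => //.
      by rewrite rmorphD rmorph1 fr Ec pchar_Fp_0 // add0r.
    exact: sum_of_powers1.
  have -> : r = b ^+ k * (- r) by rewrite Eb mulrNN mul1r.
  apply: sum_of_powersM; apply: (@sum_of_powers_residue _ (p - c)) => //; first lia.
  by rewrite rmorphN fr natrB // pchar_Fp_0 // sub0r.
(* Adding 1 to each of the t powers moves their residues into {0, 1, 2}; the
   sum -1 then needs an integer congruent to -1 mod p and at most 2 t. *)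
move=> t sums; have [r fr] := residue_lift (-1 - t%:R).
have [x Ex] := sums r.
have [|n nt En] := @sum_residues_le t 2 (fun i => f (x i) ^+ k + 1).
  move=> i; have [->|fx0] := eqVneq (f (x i)) 0.
    by rewrite expr0n; case: (k) pk => [|k' _]; rewrite ?dvdn0 // add0r.
  case: (Fp_half_power p_prime p_odd fx0) => ->; last by rewrite addNr.
  by rewrite -[1 + 1]/(2%:R) val_Fp_nat // leq_mod.
have : (p %| n.+1)%N.
  rewrite -Fp_natr_eq0 // -natr1 -En big_split /= sumr_const card_ord.
  under eq_bigr do rewrite -rmorphXn.
  by rewrite -rmorph_sum Ex fr subrK addNr.
by move/dvdn_leq => /(_ isT); lia.
Qed.

(** The ideal provided by [nakayama_set] for [m = ker f] contains every product
    of two elements of [m], hence all sums of [k]-th powers from [m]; [z] is an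
    element of [m] outside it.  The hypothesis on [r] says that [m != 0]. *)
Lemma kernel_not_sum_of_powers (r : R) :
    r != 0 -> f r = 0 ->
  exists2 z, f z = 0
    & forall k t (x : 'I_t -> R), (1 < k)%N -> (forall i, f (x i) = 0) ->
      \sum_(i < t) x i ^+ k <> z.
Proof.
move=> r0 fr; pose I := [set x | f x == 0].
have iI : ideal_set I.
  apply/ideal_setP; split=> [|a u v]; rewrite !inE ?rmorph0 // => /eqP fu /eqP fv.
  by rewrite rmorphD rmorphM fu fv mulr0 addr0.
have [|||J [iJ JI] [z zI zJ]] := @nakayama_set R I => //.
- by apply/eqP=> E; have : r \in I; [rewrite inE fr | rewrite E inE (negPf r0)].
- move=> y; rewrite inE => /eqP fy; apply: f_unit.
  by rewrite rmorphB rmorph1 fy subr0 oner_neq0.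
exists z; first by move: zI; rewrite inE => /eqP.
move=> k t x k1 fx Ez; case/negP: zJ; rewrite -Ez.
apply: (big_ind (fun u => u \in J)) => [|u v|i _]; first by case/ideal_setP: iJ.
  exact: ideal_setD.
rewrite -(subnK k1) exprD; apply: ideal_setM => //.
by rewrite expr2; apply: JI; rewrite inE fx.
Qed.

Lemma waring_squares_3mod4 (r : R) :
  r != 0 -> f r = 0 -> p = 3 %[mod 4] -> is_waring_number R 2 3.
Proof.
move=> r0 fr p34; have p_odd : odd p by lia.
have p2 : (2 < p)%N by exact: odd_prime_gt2.
have two_squares (y : R) : f y != 0 -> sum_of_powers 2 2 y.
  have [a [b Eab]] := Fp_sum_two_squares p_prime p_odd (f y).
  (* The summand with nonzero residue absorbs the error of lifting the other. *)
  wlog a0 : a b Eab / a != 0 => [W fy|_].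
    have [a0|] := eqVneq a 0; last by move=> a0; apply: (W a b).
    have [b0|] := eqVneq b 0; last by move=> b0; apply: (W b a); rewrite // addrC.
    by move: fy; rewrite Eab a0 b0 expr0n addr0 eqxx.
  have [[u fu] [v fv]] := (residue_lift a, residue_lift b).
  have [|||w Ew] := @unit_power_lift 2 u (y - v ^+ 2).
  - by rewrite gtnNdvd.
  - by rewrite fu.
  - by rewrite rmorphB rmorphXn fu fv Eab addrK.
  rewrite -[y](subrK (v ^+ 2)) -Ew.
  by apply: (@sum_of_powersD _ 2 1 1); apply: sum_of_powers1.
split.
  move=> y; have [fy0|fy0] := eqVneq (f y) 0; last first.
    by apply: (@sum_of_powers_leq _ _ 2) => //; apply: two_squares.
  rewrite -[y](subrKC 1); apply: (@sum_of_powersD _ 2 1 2).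
    by rewrite -[1](expr1n _ 2); apply: sum_of_powers1.
  by apply: two_squares; rewrite rmorphB rmorph1 fy0 sub0r oppr_eq0 oner_neq0.
move=> t sums; rewrite leqNgt; apply/negP=> t2.
have [z fz z_not] := kernel_not_sum_of_powers r0 fr.
have [x Ex] : sum_of_powers 2 2 z by apply: (@sum_of_powers_leq _ _ t).
have : f (x ord0) ^+ 2 + f (x ord_max) ^+ 2 = 0.
  rewrite -!rmorphXn -rmorphD -fz -Ex big_ord_recr big_ord1 /=.
  by congr (f (x _ ^+ 2 + _)); apply: val_inj.
(* As (p - 1) / 2 is odd, u ^ 2 = - v ^ 2 with u, v nonzero would give 1 = -1
   after raising to that power. *)
have sum_squares_eq0 (u v : 'F_p) : u ^+ 2 + v ^+ 2 = 0 -> u = 0.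
  move=> /eqP; rewrite addrC addr_eq0 => /eqP Ev; apply/eqP; apply: contraT => u0.
  have v0 : v != 0.
    by apply: contraNneq u0 => v0; rewrite -sqrf_eq0 -oppr_eq0 -Ev v0 expr0n.
  have : (v ^+ 2) ^+ p.-1./2 = - 1.
    rewrite Ev exprNn -exprM (_ : (2 * p.-1./2 = p.-1)%N); last by lia.
    by rewrite Fp_fermat // mulr1 -signr_odd (_ : odd p.-1./2) //; lia.
  rewrite -exprM (_ : (2 * p.-1./2 = p.-1)%N); last by lia.
  rewrite Fp_fermat // => /eqP; rewrite -addr_eq0 -(natrD _ 1 1) Fp_natr_eq0 //.
  by rewrite gtnNdvd.
move=> E; apply: (z_not 2 2 x) Ex => // i.
have [i0|i0] := posnP i.
  by rewrite (_ : i = ord0); [exact: sum_squares_eq0 E | apply: val_inj].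
rewrite (_ : i = ord_max); last by apply: val_inj => /=; have := ltn_ord i; lia.
by rewrite addrC in E; exact: sum_squares_eq0 E.
Qed.

Lemma waring_p_minus1 (r : R) :
  odd p -> r != 0 -> f r = 0 -> is_waring_number R (p - 1) p.
Proof.
move=> p_odd r0 fr; have p2 : (2 < p)%N by exact: odd_prime_gt2.
split.
  move=> y; have [c cp fy] := Fp_residue_pos (f y).
  by apply: sum_of_powers_residue fy; rewrite // gtnNdvd //; lia.
move=> t sums; have [z fz z_not] := kernel_not_sum_of_powers r0 fr.
have [x Ex] := sums z.
(* The booleans u i count the unit summands, each of residue 1. *)
pose u i := f (x i) != 0.
have : (p %| \sum_(i < t) u i)%N.
  rewrite -Fp_natr_eq0 //; apply/eqP; rewrite -[RHS]fz natr_sum -Ex rmorph_sum.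
  apply: eq_bigr => i _.
  rewrite rmorphXn /u; have [->|fx0] := eqVneq (f (x i)) 0.
    by rewrite expr0n subn_eq0 leqNgt prime_gt1.
  by rewrite subn1 Fp_fermat.
have ut : (\sum_(i < t) u i <= t)%N.
  rewrite -[X in (_ <= X)%N]card_ord -sum1_card.
  by apply: leq_sum => i _; case: (u i).
have [/eqP|u0 /dvdn_leq -/(_ u0) pu] := posnP (\sum_(i < t) u i)%N; last first.
  exact: leq_trans pu ut.
rewrite sum_nat_eq0 => /forallP u0 _; case: (z_not (p - 1)%N t x) => //; first lia.
by move=> i; have := u0 i; rewrite eqb0 negbK => /eqP.
Qed.

End ResidueMap.

Unset Implicit Arguments.

Theorem corollary7p7 (p s : nat) (R : finComNzRingType) (m : idealr R)
    (p_prime : prime p) (p_odd : odd p)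
    (R_local : local_ring_with m)
    (R_size : #|R| = p ^ s)
    (R_residue : ring_isomorphic {ideal_quot m} 'F_p) :
  (p = 1 %[mod 4] -> is_waring_number R 2 2) /\
  (p = 3 %[mod 4] -> 1 < s -> is_waring_number R 2 3) /\
  (5 <= p -> is_waring_number R ((p - 1) %/ 2) ((p - 1) %/ 2)) /\
  (1 < s -> is_waring_number R (p - 1) p).
Proof.
have [f fm] := residue_morphism R_residue.
have f_unit (x : R) : (f x != 0)%R -> exists y, (x * y = 1)%R.
  by rewrite fm; apply: local_ring_unit.
have kernel_nonzero : 1 < s -> exists2 r : R, (r != 0)%R & f r = 0%R.
  (* Otherwise f is injective, and R has at most p elements. *)
  move=> s1.
  have /existsP[r /andP[r0 /eqP fr]] : [exists r, (r != 0)%R && (f r == 0)%R].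
    apply: contraLR s1 => /existsPn f_inj.
    have inj_f : injective f.
      move=> x y /eqP; rewrite -GRing.subr_eq0 -GRing.rmorphB => fxy.
      apply/eqP; rewrite -GRing.subr_eq0; apply: contraT => xy.
      by have := f_inj (x - y)%R; rewrite xy fxy.
    have := leq_card f inj_f; rewrite R_size card_Fp // -{2}[p]expn1.
    by rewrite (leq_exp2l _ _ (prime_gt1 p_prime)) leqNgt.
  by exists r.
split; first exact: waring_squares_1mod4 f_unit.
split.
  by move=> p34 /kernel_nonzero[r r0 fr]; apply: waring_squares_3mod4 fr p34.
split; first exact: waring_half_p_minus1 f_unit.
by move=> /kernel_nonzero[r r0 fr]; apply: waring_p_minus1 fr.
Qed.
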